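(* Every thin group of fractions satisfies a quadratic isoperimetric inequality.
   Context: Let $M$ be a cancellative monoid (left and right cancellative). Its units form a group $M^*$. For $x,y\in M$, write $x\preceq y$ ($x$ is a left divisor of $y$, and $y$ is a multiple of $x$) if $y=xz$ for some $z\in M$. A subset $S\subseteq M$ spans $M$ if: (a) $S$ generates $M$; (b) $1\in S$; (c) $xu\in S$ for all $x\in S$, $u\in M^*$; (d) whenever $x,y\in S$ and $z\in M$ satisfy $x\preceq z$ and $y\preceq z$, there exist $x',y'\in S$ with $xy'=yx'\preceq z$. The monoid $M$ is thin if it admits a finite spanning subset. An Ore monoid is a cancellative monoid in which any two elements $x,y$ admit a common multiple, i.e. some $z$ with $x\preceq z$ and $y\preceq z$. Such a monoid embeds in a group of (right) fractions $G$, in which every element has the form $xy^{-1}$ with $x,y\in M$. A group $G$ is a thin group of fractions if it is the group of fractions of some thin Ore monoid. A group $G$ satisfies a quadratic isoperimetric inequality if it has a finite presentation $\langle S;R\rangle$ for which there is a constant $C$ such that, for every $n$, every word of length $n$ in the letters $S\cup S^{-1}$ that represents $1$ in $G$ can be transformed to the empty word using at most $Cn^2$ applications of relations of $R$ (together with free reductions and insertions). *)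

(* Defs.v *)
From mathcomp Require Import all_boot.
From mathcomp Require Import classical_sets cardinality.

Set Implicit Arguments.
Unset Strict Implicit.
Unset Printing Implicit Defensive.

Local Open Scope group_scope.

Section Monoids.
Variable M : monoidType.
Implicit Types (x y z u : M) (S : set M).

Definition cancellative : Prop :=
  right_injective (@mul M) /\ left_injective (@mul M).

Definition is_unit u : Prop := exists v, u * v = 1 /\ v * u = 1.

Definition ldiv x y : Prop := exists z, y = x * z.

Definition generates S : Prop :=
  forall x, exists2 s : seq M, (forall y, y \in s -> S y) & x = \prod_(y <- s) y.

Definition spans S : Prop :=
  [/\ generates S,
      S 1,
      forall x u, S x -> is_unit u -> S (x * u)
    & forall x y z, S x -> S y -> ldiv x z -> ldiv y z ->
        exists x' y', [/\ S x', S y', x * y' = y * x' & ldiv (x * y') z] ].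

Definition thin : Prop := exists2 S : set M, finite_set S & spans S.

Definition ore : Prop :=
  cancellative /\ forall x y, exists z, ldiv x z /\ ldiv y z.

End Monoids.

Definition group_of_fractions (M : monoidType) (G : groupType) : Prop :=
  exists iota : M -> G,
    [/\ monoid_morphism iota,
        injective iota
      & forall g : G, exists x y : M, g = iota x * (iota y)^-1].

Definition thin_group_of_fractions (G : groupType) : Prop :=
  exists M : monoidType, [/\ ore M, thin M & group_of_fractions M G].

Section Presentations.
Variable A : finType.

(* The letter (a, false) stands for a, and (a, true) for its formal inverse. *)
Definition letter : Type := (A * bool)%type.
Definition word : Type := seq letter.

Definition inv_letter (l : letter) : letter := (l.1, ~~ l.2).

(* transforms R k u v: u can be turned into v using exactly k applications of
   relations of R, in either direction, and any number of free reductions and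
   free insertions.  A pair (u, v) in R is the relation u = v; a relator r is
   the pair (r, [::]). *)
Inductive transforms (R : seq (word * word)) : nat -> word -> word -> Prop :=
| transforms_refl w : transforms R 0 w w
| transforms_free_reduction k p l q w :
    transforms R k (p ++ q) w ->
    transforms R k (p ++ [:: l; inv_letter l] ++ q) w
| transforms_free_insertion k p l q w :
    transforms R k (p ++ [:: l; inv_letter l] ++ q) w ->
    transforms R k (p ++ q) w
| transforms_relation k p u v q w :
    ((u, v) \in R) || ((v, u) \in R) ->
    transforms R k (p ++ v ++ q) w ->
    transforms R k.+1 (p ++ u ++ q) w.

Variables (G : groupType) (f : A -> G).

Definition letter_val (l : letter) : G :=
  if l.2 then (f l.1)^-1 else f l.1.

Definition word_val (w : word) : G := \prod_(l <- w) letter_val l.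

(* <A | R> is the quotient of the words by the congruence that R and free
   reduction generate; f presents G when word_val induces an isomorphism from
   this quotient onto G. *)
Definition is_presentation (R : seq (word * word)) : Prop :=
  (forall g : G, exists w, word_val w = g) /\
  (forall u v : word, word_val u = word_val v <-> exists k, transforms R k u v).

End Presentations.

Definition quadratic_isoperimetric_inequality (G : groupType) : Prop :=
  exists (A : finType) (f : A -> G) (R : seq (word A * word A)),
    is_presentation f R /\
    exists C : nat, forall (n : nat) (w : word A),
      size w = n -> word_val f w = 1 ->
      exists2 k, (k <= C * n ^ 2)%N & transforms R k w [::].

(* Main.v *)
Require Import Defs.
From mathcomp Require Import all_boot.
From mathcomp Require Import classical_sets cardinality zify.

Set Implicit Arguments.
Unset Strict Implicit.
Unset Printing Implicit Defensive.

Local Open Scope group_scope.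

(** Let S be a finite spanning subset of the Ore monoid M.  The group G of
   fractions is presented by the letters of S and all the equalities of M
   between products of at most two letters.

   The spanning property is a local confluence property: two letters x and y
   dividing z are completed to a square x y' = y x' of letters whose corner
   still divides z, and such a square is one relation.  Pasting squares, two
   products u and v of letters with a common multiple z are completed to a
   rectangle u v' = v u' with |u'| = |u| and |v'| = |v|, at the cost of |u| |v|
   relations and with a corner that still divides z
   ([common_multiple_rectangle]).  This is used twice.

   - By the Ore condition some common multiple z always exists, so x^-1 v can
     be replaced with v' x'^-1.  Moving all inverse letters to the right in this
     way turns a word of length n into a fraction u v^-1 with |u| + |v| = n, at
     a quadratic cost ([transforms_to_fraction]).

   - If the word represents 1, then u and v are equal in M, as M embeds in G.
     Take z to be their common value.  The corner u v' of the rectangle divides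
     u, so v' is invertible, and likewise u'; by cancellation u' and v' are the
     same unit c of M.  Every letter of u' and v' is then a unit, and all units
     are letters, so multiplying letter by letter reduces u' and v' to the
     letter c at a linear cost ([collapse_unit]).  Hence u = u v' c^-1 =
     v u' c^-1 = v is derived at a quadratic cost ([equal_positive_words]).

   That every trivial word reduces to the empty word also shows that these
   relations present G. *)

(** * Transformations of words *)

Section Transformations.
Variables (A : finType) (R : seq (word A * word A)).
Implicit Types (p q u v w : word A) (j k : nat).

Lemma transforms_trans j k u v w :
  transforms R j u v -> transforms R k v w -> transforms R (j + k) u w.
Proof.
move=> H; elim: H w => [//|i p l q t _ IH|i p l q t _ IH|i p u1 v1 q t inR _ IH] w Hk.
- exact/transforms_free_reduction/IH.
- exact/transforms_free_insertion/IH.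
- by rewrite addSn; apply: (transforms_relation inR); apply: IH.
Qed.

Lemma transforms_sym k u v : transforms R k u v -> transforms R k v u.
Proof.
elim=> [w|i p l q t _ IH|i p l q t _ IH|i p u1 v1 q t inR _ IH].
- exact: transforms_refl.
- rewrite -[i]addn0; apply: transforms_trans IH _.
  exact/(transforms_free_insertion (l := l))/transforms_refl.
- rewrite -[i]addn0; apply: transforms_trans IH _.
  exact/transforms_free_reduction/transforms_refl.
- rewrite -addn1; apply: transforms_trans IH _.
  apply: (transforms_relation (v := u1)); first by rewrite orbC.
  exact: transforms_refl.
Qed.

Lemma transforms_context k p q u v :
  transforms R k u v -> transforms R k (p ++ u ++ q) (p ++ v ++ q).
Proof.
have E a b c : p ++ (a ++ b ++ c) ++ q = (p ++ a) ++ b ++ (c ++ q).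
  by rewrite !catA.
have E0 a c : p ++ (a ++ c) ++ q = (p ++ a) ++ (c ++ q) by rewrite !catA.
elim=> [w|i a l c t _ IH|i a l c t _ IH|i a u1 v1 c t inR _ IH].
- exact: transforms_refl.
- by rewrite E; apply: transforms_free_reduction; rewrite -E0.
- by rewrite E0; apply: (transforms_free_insertion (l := l)); rewrite -E.
- by rewrite E; apply: (transforms_relation inR); rewrite -E.
Qed.

Definition inv_word w : word A := rev (map (@inv_letter A) w).

Lemma inv_wordK : involutive inv_word.
Proof.
move=> w; rewrite /inv_word map_rev revK -map_comp map_id_in // => l _ /=.
by rewrite /inv_letter /= negbK -surjective_pairing.
Qed.

Lemma inv_word_cat u v : inv_word (u ++ v) = inv_word v ++ inv_word u.
Proof. by rewrite /inv_word map_cat rev_cat. Qed.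

Lemma transforms_mulwV w : transforms R 0 (w ++ inv_word w) [::].
Proof.
elim: w => [|l w IH]; first exact: transforms_refl.
rewrite -cat1s inv_word_cat -catA [w ++ _]catA -[0]addn0.
apply: transforms_trans (transforms_context _ _ IH) _.
exact: (@transforms_free_reduction _ _ _ [::] l [::] _ (transforms_refl _ _)).
Qed.

Definition transforms_within k u v :=
  exists2 j, (j <= k)%N & transforms R j u v.

Lemma within_le j k u v :
  (j <= k)%N -> transforms_within j u v -> transforms_within k u v.
Proof. by move=> le_jk [i le_ij H]; exists i => //; apply: leq_trans le_jk. Qed.

Lemma within_trans v j k u w :
  transforms_within j u v -> transforms_within k v w ->
  transforms_within (j + k) u w.
Proof.
move=> [i le_ij Hi] [l le_lk Hl]; exists (i + l)%N; first exact: leq_add.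
exact: transforms_trans Hl.
Qed.

Lemma within_sym k u v : transforms_within k u v -> transforms_within k v u.
Proof. by case=> j le_jk H; exists j => //; apply: transforms_sym. Qed.

Lemma within_catl k p u v :
  transforms_within k u v -> transforms_within k (p ++ u) (p ++ v).
Proof.
case=> j le_jk H; exists j => //.
by rewrite -[u]cats0 -[v]cats0; apply: transforms_context.
Qed.

Lemma within_catr k q u v :
  transforms_within k u v -> transforms_within k (u ++ q) (v ++ q).
Proof.
by case=> j le_jk H; exists j => //; apply: (transforms_context [::]).
Qed.

Lemma within_refl w : transforms_within 0 w w.
Proof. by exists 0 => //; apply: transforms_refl. Qed.

Lemma within_relation u v : (u, v) \in R -> transforms_within 1 u v.
Proof.
move=> inR; exists 1%N => //; rewrite -[u]cats0 -[v]cats0.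
apply: (transforms_relation (p := [::]) (v := v)); first by rewrite inR.
exact: transforms_refl.
Qed.

Lemma within_mulwVK u w : transforms_within 0 (u ++ w ++ inv_word w) u.
Proof.
rewrite -[X in transforms_within _ _ X]cats0; apply: within_catl.
by exists 0 => //; apply: transforms_mulwV.
Qed.

Lemma within_mulVw w : transforms_within 0 (inv_word w ++ w) [::].
Proof. by rewrite -{2}[w]inv_wordK; apply: (within_mulwVK [::]). Qed.

Lemma within_mulwK k u v w :
  transforms_within k (u ++ w) v -> transforms_within k u (v ++ inv_word w).
Proof.
move=> H; apply: within_trans (within_sym (within_mulwVK u w)) _.
by rewrite catA; apply: within_catr.
Qed.

Variables (G : groupType) (f : A -> G).

Lemma word_val_cat u v : word_val f (u ++ v) = word_val f u * word_val f v.
Proof. by rewrite /word_val big_cat. Qed.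

Lemma word_val_inv w : word_val f (inv_word w) = (word_val f w)^-1.
Proof.
elim: w => [|[a b] w IH]; first by rewrite /word_val big_nil invg1.
rewrite -cat1s inv_word_cat !word_val_cat IH invgM; congr (_ * _).
by rewrite /word_val !big_seq1 /letter_val; case: b => //=; rewrite invgK.
Qed.

Hypothesis sound :
  forall u v, (u, v) \in R -> word_val f u = word_val f v.

Lemma transforms_word_val k u v :
  transforms R k u v -> word_val f u = word_val f v.
Proof.
have valV l : word_val f [:: l; inv_letter l] = 1.
  have /= := word_val_cat [:: l] (inv_word [:: l]).
  by rewrite word_val_inv mulgV.
elim=> [//|i p l q t _ <-|i p l q t _ <-|i p u1 v1 q t inR _ <-].
- by rewrite !word_val_cat valV mul1g.
- by rewrite !word_val_cat valV mul1g.
- rewrite !word_val_cat; congr (_ * (_ * _)).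
  by case/orP: inR => /sound.
Qed.

(** Two words with the same value differ by the trivial word u v^-1. *)
Lemma is_presentation_of_trivial_words :
  (forall g, exists w, word_val f w = g) ->
  (forall w, word_val f w = 1 -> exists k, transforms R k w [::]) ->
  is_presentation f R.
Proof.
move=> surj triv; split=> // u v; split=> [uv|[k]]; last exact: transforms_word_val.
have [|k Hk] := triv (u ++ inv_word v).
  by rewrite word_val_cat word_val_inv uv mulgV.
have : transforms_within k (u ++ inv_word v) [::] by exists k.
by case/within_mulwK; rewrite inv_wordK => j _ Hj; exists j.
Qed.

End Transformations.

(** * Rectangles over a spanning set *)

(** In a cancellative monoid one-sided inverses are two-sided. *)
Lemma unit_factors (M : monoidType) (x y : M) :
  cancellative M -> is_unit (x * y) -> is_unit x /\ is_unit y.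
Proof.
move=> [canL canR] [w [xyw wxy]]; split.
- exists (y * w); split; first by rewrite mulgA.
  by apply: (canR y); rewrite /= -!mulgA wxy mulg1 mul1g.
- exists (w * x); split; last by rewrite -mulgA.
  by apply: (canL x); rewrite /= !mulgA xyw mul1g mulg1.
Qed.

Section SpanningSet.
Variables (M : monoidType) (s : seq M).
Hypothesis cancM : cancellative M.
Hypothesis spanM : spans [set` s]%classic.

Local Notation A := (seq_sub s).
Implicit Types (a b c : A) (u v : seq A) (x y z : M).

Definition eval u : M := \prod_(a <- u) ssval a.

Lemma eval_cons a u : eval (a :: u) = ssval a * eval u.
Proof. by rewrite /eval big_cons. Qed.

Lemma eval_cat u v : eval (u ++ v) = eval u * eval v.
Proof. by rewrite /eval big_cat. Qed.

Lemma eval1 a : eval [:: a] = ssval a.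
Proof. by rewrite /eval big_seq1. Qed.

Lemma eval_surj x : exists u, eval u = x.
Proof.
have [+ _ _ _] := spanM => /(_ x) [t + ->].
elim: t => [|y t IH] ts; first by exists [::]; rewrite /eval !big_nil.
have [|u uE] := IH; first by move=> w wt; apply: ts; rewrite inE wt orbT.
have ys : y \in s by apply: ts; rewrite mem_head.
by exists (SeqSub ys :: u); rewrite eval_cons uE big_cons.
Qed.

Lemma unit_letter x : is_unit x -> exists a, ssval a = x.
Proof.
have [_ S1 SU _] := spanM => ux.
have xs : x \in s by have := SU _ _ S1 ux; rewrite mul1g.
by exists (SeqSub xs).
Qed.

Lemma common_multiple_square a b z :
  ldiv (ssval a) z -> ldiv (ssval b) z ->
  exists a' b', ssval a * ssval b' = ssval b * ssval a' /\
                ldiv (ssval a * ssval b') z.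
Proof.
have [_ _ _ lcm] := spanM => az bz.
have [x [y [xs ys xy yz]]] := lcm _ _ _ (ssvalP a) (ssvalP b) az bz.
by exists (SeqSub xs), (SeqSub ys).
Qed.

Lemma ldiv_mul2l x y z : ldiv (x * y) (x * z) -> ldiv y z.
Proof. by case=> w; rewrite -mulgA => /(cancM.1 x) ->; exists w. Qed.

Lemma ldiv_mull x y z : ldiv (x * y) z -> ldiv x z.
Proof. by case=> w ->; exists (y * w); rewrite mulgA. Qed.

Lemma ldiv_mul2 x y z : ldiv y z -> ldiv (x * y) (x * z).
Proof. by case=> w ->; exists w; rewrite mulgA. Qed.

Definition positive u : word A := [seq (a, false) | a <- u].

Lemma positive_cat u v : positive (u ++ v) = positive u ++ positive v.
Proof. exact: map_cat. Qed.

Definition short_words : seq (seq A) :=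
  [::] :: [seq [:: a] | a <- enum {: A}] ++
  [seq [:: a; b] | a <- enum {: A}, b <- enum {: A}].

Definition relations : seq (word A * word A) :=
  [seq (positive p.1, positive p.2) |
    p <- [seq (u, v) | u <- short_words, v <- short_words]
    & eval p.1 == eval p.2].

Lemma mem_short_words u : (size u <= 2)%N -> u \in short_words.
Proof.
rewrite inE mem_cat; case: u => [//|a [|b [|//]]] _; apply/orP; right.
  by apply/orP; left; apply: map_f; rewrite mem_enum.
by apply/orP; right; apply: allpairs_f; rewrite mem_enum.
Qed.

Lemma mem_relations u v :
  (size u <= 2)%N -> (size v <= 2)%N -> eval u = eval v ->
  (positive u, positive v) \in relations.
Proof.
move=> su sv uv; apply/mapP; exists (u, v) => //.
by rewrite mem_filter uv eqxx allpairs_f ?mem_short_words.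
Qed.

Local Notation within := (transforms_within relations).

(** One row of squares.  Prescribing z, rather than some common multiple of a
   and v, is what lets the induction go on: after cancelling the first letter b
   of v, both the new vertical letter a1 and the rest of v divide the rest w of
   z. *)
Lemma common_multiple_strip a v z :
  ldiv (ssval a) z -> ldiv (eval v) z ->
  exists a' v', [/\ size v' = size v,
    eval (a :: v') = eval (v ++ [:: a']), ldiv (eval (a :: v')) z
  & within (size v) (positive (a :: v')) (positive (v ++ [:: a']))].
Proof.
elim: v a z => [|b v IH] a z az vz.
  exists a, [::]; split=> //; last exact: within_refl.
  by rewrite eval1.
rewrite eval_cons in vz.
have [a1 [b1 [sq corner]]] := common_multiple_square az (ldiv_mull vz).
have [w zE] := ldiv_mull vz.
have [||a' [v' [sv' ev' v'w Hv']]] := IH a1 w.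
- by apply: (@ldiv_mul2l (ssval b)); rewrite -sq -zE.
- by apply: (@ldiv_mul2l (ssval b)); rewrite -zE.
exists a', (b1 :: v'); split.
- by rewrite /= sv'.
- by rewrite cat_cons !eval_cons mulgA sq -mulgA -ev' eval_cons.
- rewrite !eval_cons mulgA sq -mulgA zE; apply: ldiv_mul2.
  by rewrite -eval_cons.
- rewrite -[size _]/(1 + size v)%N.
  apply: (@within_trans _ _ (positive ([:: b; a1] ++ v'))).
    rewrite -[a :: _]/([:: a; b1] ++ v') !positive_cat; apply: within_catr.
    by apply/within_relation/mem_relations; rewrite // !eval_cons !mulgA sq.
  by rewrite cat_cons; apply: (@within_catl _ _ _ [:: (b, false)]).
Qed.

Lemma common_multiple_rectangle u v z :
  ldiv (eval u) z -> ldiv (eval v) z ->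
  exists u' v', [/\ size u' = size u, size v' = size v,
    eval (u ++ v') = eval (v ++ u'), ldiv (eval (u ++ v')) z
  & within (size u * size v) (positive (u ++ v')) (positive (v ++ u'))].
Proof.
elim: u v z => [|a u IH] v z uz vz.
  exists [::], v; split=> //; rewrite ?cats0 //; exact: within_refl.
rewrite eval_cons in uz.
have [a1 [v1 [sv1 ev1 v1z Hv1]]] := common_multiple_strip (ldiv_mull uz) vz.
have [w zE] := ldiv_mull uz.
have [||u' [v' [su' sv' euv uv'w H]]] := IH v1 w.
- by apply: (@ldiv_mul2l (ssval a)); rewrite -zE.
- by apply: (@ldiv_mul2l (ssval a)); rewrite -zE -eval_cons.
exists (a1 :: u'), v'; rewrite sv' sv1; split=> //.
- by rewrite /= su'.
- by rewrite cat_cons eval_cons euv -[a1 :: u']cat1s catA [RHS]eval_cat -ev1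
             -[RHS]eval_cat cat_cons eval_cons.
- by rewrite cat_cons eval_cons zE; apply: ldiv_mul2.
- rewrite mulSn addnC.
  apply: (@within_trans _ _ (positive (a :: v1 ++ u'))).
    by rewrite -sv1; apply: (@within_catl _ _ _ [:: (a, false)]).
  rewrite -[a :: _]/((a :: v1) ++ u') -[a1 :: u']cat1s catA.
  rewrite (positive_cat (a :: v1)) (positive_cat (v ++ _)).
  exact: within_catr.
Qed.

(** * Reduction of trivial words *)

(** Each letter is absorbed in the current unit by a relation b c = d, which is
   available because all units are letters; the extra relation 1 = d accounts
   for the empty word. *)
Lemma collapse_unit u : is_unit (eval u) ->
  exists c, ssval c = eval u /\
            within (size u).+1 (positive u) (positive [:: c]).
Proof.
elim: u => [|b u IH] unit_u.
  have [c cE] := unit_letter unit_u; exists c; split=> //.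
  by apply/within_relation/(@mem_relations [::]); rewrite // eval1.
have [c cE] := unit_letter unit_u; exists c; split=> //.
rewrite eval_cons in unit_u.
have [_ /IH [d [dE Hd]]] := unit_factors cancM unit_u.
rewrite -addn1; apply: (@within_trans _ _ (positive [:: b; d])).
  exact: (@within_catl _ _ _ [:: (b, false)]).
apply/within_relation/mem_relations => //.
by rewrite eval1 cE !eval_cons -dE /eval big_nil mulg1.
Qed.

Lemma equal_positive_words u v : eval u = eval v ->
  within (size u * size v + size u + size v + 2) (positive u) (positive v).
Proof.
move=> uv.
have self : ldiv (eval u) (eval u) by exists 1; rewrite mulg1.
have [||u' [v' [su' sv' euv uv'z H]]] := @common_multiple_rectangle u v (eval u).
- by [].
- by rewrite -uv.
have u'v' : eval u' = eval v'.
  by apply: (cancM.1 (eval u)); rewrite /= -[RHS]eval_cat euv eval_cat uv.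
have unit_v' : is_unit (eval v').
  case: uv'z => w; rewrite eval_cat -mulgA -{1}[eval u]mulg1.
  move/cancM.1 => v'w; apply: (proj1 (@unit_factors _ _ w cancM _)).
  by rewrite -v'w; exists 1; rewrite mulg1.
have [c [cE Hc]] := collapse_unit unit_v'.
have [|d [dE Hd]] := @collapse_unit u'; first by rewrite u'v'.
have dc : d = c by apply: val_inj; rewrite /= dE u'v' cE.
rewrite {}dc {dE} su' sv' in Hc Hd *.
(* u = u v' c^-1 = v u' c^-1 = v *)
have uc_vc : within (size u * size v + size u + size v + 2)
    (positive u ++ positive [:: c]) (positive v ++ positive [:: c]).
  have -> : (size u * size v + size u + size v + 2 =
    (size v).+1 + (size u * size v + (size u).+1))%N by lia.
  apply: within_trans (within_catl _ (within_sym Hc)) _.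
  rewrite -positive_cat; apply: within_trans H _.
  by rewrite positive_cat; apply: within_catl.
have := within_mulwK uc_vc; rewrite -catA => /within_trans.
by move=> /(_ _ _ (within_mulwVK _ _ _)); rewrite addn0.
Qed.

Hypothesis oreM : forall x y, exists z, ldiv x z /\ ldiv y z.

Lemma transforms_to_fraction (w : word A) :
  exists u v, (size u + size v = size w)%N /\
    within (size w ^ 2) w (positive u ++ inv_word (positive v)).
Proof.
elim: w => [|[a b] w [u [v [suv H]]]].
  by exists [::], [::]; split=> //; apply: within_refl.
have Hw := @within_catl _ _ _ [:: (a, b)] _ _ H.
have le_sq j : (j <= size w)%N -> (size w ^ 2 + j <= (size w).+1 ^ 2)%N by nia.
case: b Hw => Hw; last first.
  (* A new positive letter joins the numerator at no cost. *)
  exists (a :: u), v; split; first by rewrite /= addSn suv.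
  by apply: within_le Hw; rewrite -[(size w ^ 2)%N]addn0 le_sq.
have [z [az uz]] := oreM (ssval a) (eval u).
have [a' [u' [su' _ _ Hu']]] := common_multiple_strip az uz.
exists u', (v ++ [:: a']); split; first by rewrite size_cat su' addnA suv addn1.
apply: within_le (le_sq (size u) _) _; first by rewrite -suv leq_addr.
apply: within_trans Hw _.
rewrite positive_cat inv_word_cat !catA; apply: within_catr.
(* a^-1 u = a^-1 u a' a'^-1 = a^-1 a u' a'^-1 = u' a'^-1 *)
apply: within_mulwK; rewrite -catA -positive_cat -[size u]addn0.
apply: within_trans (within_catl _ (within_sym Hu')) _.
exact: (within_catr (positive u') (within_mulVw _ [:: (a, false)])).
Qed.

Variables (G : groupType) (iota : M -> G).
Hypotheses (iotaM : monoid_morphism iota) (iota_inj : injective iota).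

Local Notation f := (fun a : A => iota (ssval a)).

Lemma word_val_positive u : word_val f (positive u) = iota (eval u).
Proof.
elim: u => [|a u IH]; first by rewrite /word_val /eval !big_nil iotaM.1.
rewrite eval_cons iotaM.2 -IH -[positive (a :: u)]cat1s word_val_cat.
by rewrite {1}/word_val big_seq1.
Qed.

Lemma relations_sound p q : (p, q) \in relations -> word_val f p = word_val f q.
Proof.
case/mapP=> [[u v]]; rewrite mem_filter /= => /andP[/eqP uv _] [-> ->].
by rewrite !word_val_positive uv.
Qed.

Lemma trivial_word_within (w : word A) :
  word_val f w = 1 -> within (5 * size w ^ 2) w [::].
Proof.
case: (posnP (size w)) => [/size0nil -> _|w_gt0 w1]; first exact: within_refl.
have [u [v [suv Hw]]] := transforms_to_fraction w.
have uv : eval u = eval v.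
  apply/iota_inj/divg1_eq; rewrite -!word_val_positive -word_val_inv -word_val_cat.
  by case: Hw => j _ /(transforms_word_val relations_sound) <-.
have Huv := within_catr (inv_word (positive v)) (equal_positive_words uv).
(* The total cost n^2 + (|u| |v| + n + 2) is at most 5 n^2, since n >= 1. *)
have := within_trans Huv (within_mulwVK _ [::] _).
by move/(within_trans Hw); apply: within_le; nia.
Qed.

End SpanningSet.

Theorem theorem1p1 (G : groupType) :
  thin_group_of_fractions G -> quadratic_isoperimetric_inequality G.
Proof.
case=> M [[cancM oreM] [S /finite_seqP [s ->] spanM] [iota [iotaM iota_inj iotaG]]].
exists (seq_sub s), (fun a => iota (ssval a)), (relations s).
have triv := trivial_word_within cancM spanM oreM iotaM iota_inj.
split.
  apply: is_presentation_of_trivial_words.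
  - exact: relations_sound.
  - move=> g; have [x [y ->]] := iotaG g.
    have [[u <-] [v <-]] := (eval_surj spanM x, eval_surj spanM y).
    exists (positive u ++ inv_word (positive v)).
    by rewrite word_val_cat word_val_inv !word_val_positive.
  - by move=> w /triv [k _ Hk]; exists k.
by exists 5%N => n w <- /triv.
Qed.
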